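(* For any finite irreducible Markov chain with no absorbing state and with rational transition probabilities, the zero vector $\mathbf{0}$ is a recurrent hunger state. Moreover, the number of steps needed to return to $\mathbf{0}$ (the least positive number of hunger game steps after which the hunger vector, started at $\mathbf{0}$, equals $\mathbf{0}$ again) is the least common denominator of the stationary probabilities $\pi(1),\dots,\pi(n)$ of the Markov chain.
   Context: Let $P$ be the transition matrix of the chain, with states $1,\dots,n$; let $H=P-I$ with rows $H_i$; and let $\pi$ be the unique stationary distribution. A state $k$ is absorbing if $P_{kk}=1$. One step of the hunger game replaces a hunger vector $\mathbf{h}\in\mathbb{R}^n$ by $\mathbf{h}+H_i$, where $i$ is the smallest index with $\mathbf{h}_i=\max_j\mathbf{h}_j$. A hunger vector is recurrent if it returns to itself after some positive finite number of steps of the hunger game. The least common denominator of the stationary probabilities is the least positive integer $m$ such that $m\pi(i)$ is an integer for all $i$. *)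

(* Defs.v *)
From mathcomp Require Export all_boot all_order all_algebra.
From mathcomp Require Export reals.

Set Implicit Arguments.
Unset Strict Implicit.
Unset Printing Implicit Defensive.

Import Order.TTheory GRing.Theory Num.Theory.
Local Open Scope ring_scope.

Definition is_least_positive (Q : nat -> Prop) (m : nat) : Prop :=
  [/\ (0 < m)%N, Q m & forall k : nat, (0 < k)%N -> Q k -> (m <= k)%N].

(* A finite chain has at least one state, so the number of states is n.+1;
   P i j is the probability of moving from i to j. *)

Definition transition_matrix (R : realType) (n : nat) (P : 'M[R]_n.+1) : Prop :=
  (forall i j, 0 <= P i j) /\ (forall i, \sum_j P i j = 1).

Definition rational_entries (R : realType) (n : nat) (P : 'M[R]_n.+1) : Prop :=
  forall i j, exists q : rat, P i j = ratr q.

Definition irreducible_chain (R : realType) (n : nat) (P : 'M[R]_n.+1) : Prop :=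
  forall i j, exists k : nat, 0 < (P ^+ k) i j.

Definition absorbing (R : realType) (n : nat) (P : 'M[R]_n.+1)
  (k : 'I_n.+1) : Prop := P k k = 1.

Definition stationary_distribution (R : realType) (n : nat)
  (P : 'M[R]_n.+1) (p : 'rV[R]_n.+1) : Prop :=
  [/\ forall i, 0 <= p 0 i, \sum_i p 0 i = 1 & p *m P = p].

Definition max_hunger (R : realType) (n : nat) (h : 'rV[R]_n.+1)
  (i : 'I_n.+1) : bool := [forall j, h 0 j <= h 0 i].

(* The default value of arg min must itself be a maximizer, whence the inner
   arg max; hungriestP shows that the result is the least maximizing index. *)
Definition hungriest (R : realType) (n : nat) (h : 'rV[R]_n.+1) : 'I_n.+1 :=
  let i0 := [arg max_(j > ord0) h ord0 j]%O in
  [arg min_(i < i0 | max_hunger h i) (i : nat)]%N.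

Lemma hungriestP (R : realType) (n : nat) (h : 'rV[R]_n.+1) :
  (forall j, h 0 j <= h 0 (hungriest h)) /\
  (forall i, (forall j, h 0 j <= h 0 i) -> (hungriest h <= i)%N).
Proof.
rewrite /hungriest; case: arg_minnP => [|i /forallP imax imin].
  by case: arg_maxP => // i _ imax; apply/forallP => j; exact: imax.
by split=> // j jmax; apply: imin; apply/forallP.
Qed.

Definition hunger_matrix (R : realType) (n : nat) (P : 'M[R]_n.+1) :
  'M[R]_n.+1 := P - 1%:M.

Definition hunger_step (R : realType) (n : nat) (P : 'M[R]_n.+1)
  (h : 'rV[R]_n.+1) : 'rV[R]_n.+1 :=
  h + row (hungriest h) (hunger_matrix P).

Definition returns_after (R : realType) (n : nat) (P : 'M[R]_n.+1)
  (h : 'rV[R]_n.+1) (t : nat) : Prop := iter t (hunger_step P) h = h.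

Definition hunger_recurrent (R : realType) (n : nat) (P : 'M[R]_n.+1)
  (h : 'rV[R]_n.+1) : Prop :=
  exists2 t : nat, (0 < t)%N & returns_after P h t.

Definition is_return_time (R : realType) (n : nat) (P : 'M[R]_n.+1)
  (h : 'rV[R]_n.+1) (t : nat) : Prop :=
  is_least_positive (returns_after P h) t.

Definition is_least_common_denominator (R : realType) (n : nat)
  (p : 'rV[R]_n.+1) (m : nat) : Prop :=
  is_least_positive (fun k => forall i, k%:R * p 0 i \is a Num.int) m.

(* Main.v *)
Require Import Defs.
From mathcomp Require Import all_boot all_order all_algebra.
From mathcomp Require Import reals.

Set Implicit Arguments.
Unset Strict Implicit.
Unset Printing Implicit Defensive.

Import Order.TTheory GRing.Theory Num.Theory.
Local Open Scope ring_scope.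

(** Started at 0, the hunger vector after t steps is c H, where c_i counts how
    often i has been fired; it vanishes iff c = t p, with p the stationary
    distribution.  Let m be the least common denominator of p and v = m p.  If
    the counts c were about to exceed v for the first time, at state i, then
    c <= v and c_i = v_i, so that h_i = ((c - v)H)_i = - ((v - c)P)_i <= 0.  As
    h_i is the maximum of a vector with sum 0, h = 0, which forces c = v.
    Hence the counts stay below v during the first m steps, and c = v after
    exactly m of them. *)

(** * Fixed row vectors of a stochastic matrix *)

(** The triangle inequality gives [|w| <= |w| P] entrywise. The result lets a signed fixed vector be
    replaced by a nonnegative one. *)
Lemma stationary_norm (R : realType) (n : nat) (P : 'M[R]_n.+1)
    (w : 'rV[R]_n.+1) :
  transition_matrix P -> w *m P = w ->
  map_mx Num.norm w *m P = map_mx Num.norm w.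
Proof.
move=> [P_ge0 P_sum] wP; set a := map_mx _ w.
have le_a j : a 0 j <= (a *m P) 0 j.
  rewrite /a mxE -{1}wP !mxE; apply: le_trans (ler_norm_sum _ _ _) _.
  by apply: ler_sum => i _; rewrite normrM mxE (ger0_norm (P_ge0 _ _)).
(* Both sides have the same total mass, so the entrywise inequality is sharp. *)
have sum_eq : \sum_j ((a *m P) 0 j - a 0 j) = 0.
  rewrite sumrB; apply/eqP; rewrite subr_eq0; apply/eqP.
  under eq_bigr do rewrite mxE.
  rewrite exchange_big /=; apply: eq_bigr => i _.
  by rewrite -mulr_sumr P_sum mulr1.
apply/rowP => j; apply/eqP; rewrite -subr_eq0.
have/eqP := sum_eq; rewrite psumr_eq0; last by move=> i _; rewrite subr_ge0.
by move/allP/(_ j (mem_index_enum _)).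
Qed.

Lemma stationary_pow (R : realType) (n : nat) (P : 'M[R]_n.+1)
    (w : 'rV[R]_n.+1) (k : nat) :
  w *m P = w -> w *m P ^+ k = w.
Proof.
by move=> wP; elim: k => [|k IH]; rewrite ?expr0 ?mulmx1 // exprS mulmxA wP.
Qed.

(** In [|w| P^k = |w|] the entry at [i] is a vanishing sum of nonnegative terms, and irreducibility
    gives a [k] for which the term of [j] has a positive coefficient. *)
Lemma stationary_eq0 (R : realType) (n : nat) (P : 'M[R]_n.+1)
    (w : 'rV[R]_n.+1) (i : 'I_n.+1) :
  transition_matrix P -> irreducible_chain P ->
  w *m P = w -> w 0 i = 0 -> w = 0.
Proof.
move=> Pt Pirr wP wi0; apply/rowP => j; rewrite mxE; apply/eqP.
have [k Pk] := Pirr j i.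
have Pk_ge0 l : 0 <= (P ^+ k) l i.
  elim: k l {Pk} => [|k IH] l; first by rewrite expr0 mxE ler0n.
  by rewrite exprS mxE; apply: sumr_ge0 => s _; rewrite mulr_ge0 // Pt.1.
have/rowP/(_ i) := stationary_pow k (stationary_norm Pt wP).
rewrite !mxE wi0 normr0 => /eqP.
rewrite psumr_eq0; last by move=> l _; rewrite mulr_ge0 // mxE.
move/allP/(_ j (mem_index_enum _)); rewrite mxE mulf_eq0 normr_eq0.
by rewrite (gt_eqF Pk) orbF.
Qed.

Lemma stationary_gt0 (R : realType) (n : nat) (P : 'M[R]_n.+1)
    (p : 'rV[R]_n.+1) (i : 'I_n.+1) :
  transition_matrix P -> irreducible_chain P -> stationary_distribution P p ->
  0 < p 0 i.
Proof.
move=> Pt Pirr [p_ge0 p_sum pP]; rewrite lt_def p_ge0 andbT.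
apply/eqP => /(stationary_eq0 Pt Pirr pP) p0; move: p_sum.
rewrite p0 big1 => [/eqP|j _]; last by rewrite mxE.
by rewrite eq_sym oner_eq0.
Qed.

(** Subtracting the multiple of [p] that agrees with [w] at state 0 leaves a fixed vector with a
    zero entry, hence 0. Summing entries identifies the factor. *)
Lemma stationary_unique (R : realType) (n : nat) (P : 'M[R]_n.+1)
    (p w : 'rV[R]_n.+1) :
  transition_matrix P -> irreducible_chain P -> stationary_distribution P p ->
  w *m P = w -> w = (\sum_i w 0 i) *: p.
Proof.
move=> Pt Pirr pst wP; have [_ p_sum pP] := pst.
have p00 : p 0 0 != 0 by rewrite gt_eqF // (stationary_gt0 0 Pt Pirr pst).
have/eqP : w - (w 0 0 / p 0 0) *: p = 0.
  apply: (stationary_eq0 (i := 0) Pt Pirr).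
    by rewrite mulmxBl wP -scalemxAl pP.
  by rewrite !mxE divfK // subrr.
rewrite subr_eq0 => /eqP wE; rewrite {1}wE; congr (_ *: _).
rewrite [in RHS]wE; under eq_bigr do rewrite mxE.
by rewrite -mulr_sumr p_sum mulr1.
Qed.

(** * Rationality of the stationary distribution and common denominators *)

(** Over [rat] the matrix [Q - 1] is already singular, so it has a nonzero rational left null vector
    [u]; its absolute values are then normalised. *)
Lemma rational_stationary (R : realType) (n : nat) (P : 'M[R]_n.+1) :
  transition_matrix P -> rational_entries P ->
  exists q : 'rV[rat]_n.+1, stationary_distribution P (map_mx ratr q).
Proof.
move=> Pt Prat.
have /fin_all_exists2 [f _ fE] : forall ij : 'I_n.+1 * 'I_n.+1,
    exists2 q : rat, true & P ij.1 ij.2 = ratr q.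
  by move=> ij; have [q] := Prat ij.1 ij.2; exists q.
pose Q : 'M[rat]_n.+1 := \matrix_(i, j) f (i, j).
have PQ : P = map_mx ratr Q by apply/matrixP => i j; rewrite !mxE -fE.
have : \det (Q - 1%:M) == 0.
  (* [det0P] asks for a left null vector; for the transpose the all-ones vector is one, since the
     rows of [P] sum to 1. *)
  rewrite -det_tr; apply/det0P; exists (const_mx 1).
    by apply/eqP => /rowP/(_ 0); rewrite !mxE => /eqP; rewrite oner_eq0.
  apply: (map_mx_inj (f := @ratr R)); apply/rowP => i; rewrite !mxE rmorph_sum /=.
  under eq_bigr do rewrite !mxE mul1r rmorphB /= -(fE (i, _)) /= rmorph_nat.
  rewrite sumrB Pt.2 (bigD1 i) //= eqxx big1 ?addr0 ?subrr ?raddf0 //.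
  by move=> j /negPf ji; rewrite eq_sym ji.
case/det0P => u u0 /eqP; rewrite mulmxBr mulmx1 subr_eq0 => /eqP uQ.
pose s := \sum_i `|u 0 i|.
have s0 : s != 0.
  apply: contraNneq u0 => /eqP; rewrite psumr_eq0 // => /allP us.
  apply/eqP/rowP => i; rewrite mxE; apply/eqP; rewrite -normr_eq0.
  exact: us i (mem_index_enum _).
have wP : map_mx (@ratr R) u *m P = map_mx ratr u by rewrite PQ -map_mxM uQ.
have qE : map_mx (@ratr R) (s^-1 *: map_mx Num.norm u) =
    ratr s^-1 *: map_mx Num.norm (map_mx ratr u).
  by apply/rowP => i; rewrite !mxE rmorphM /= ratr_norm.
exists (s^-1 *: map_mx Num.norm u); split.
- move=> i; rewrite !mxE ler0q mulr_ge0 // invr_ge0.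
  exact: sumr_ge0.
- under eq_bigr do rewrite !mxE.
  by rewrite -rmorph_sum -mulr_sumr mulVf // rmorph1.
- by rewrite qE -scalemxAl (stationary_norm Pt wP).
Qed.

Lemma common_denominator (n : nat) (q : 'rV[rat]_n) :
  exists2 k : nat, (0 < k)%N & forall i, k%:R * q 0 i \is a Num.int.
Proof.
exists (\prod_i `|denq (q 0%R i)|)%N.
  by apply: prodn_gt0 => i; rewrite absz_gt0 denq_neq0.
move=> i; rewrite (bigD1 i) //= natrM mulrAC rpredM ?natr_int //.
rewrite pmulrn absz_denq mulrC -{1}(divq_num_den (q 0 i)) divfK ?intr_int //.
by rewrite intr_eq0 denq_neq0.
Qed.

Lemma lcd_exists (R : realType) (n : nat) (P : 'M[R]_n.+1)
    (p : 'rV[R]_n.+1) :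
  transition_matrix P -> rational_entries P -> irreducible_chain P ->
  stationary_distribution P p -> exists m, is_least_common_denominator p m.
Proof.
move=> Pt Prat Pirr pst.
have [q [_ q_sum qP]] := rational_stationary Pt Prat.
(* By uniqueness [p] is the rational solution, so it has a common denominator. *)
have pE : p = map_mx ratr q.
  by rewrite (stationary_unique Pt Pirr pst qP) q_sum scale1r.
pose Q k := (0 < k)%N && [forall i, k%:R * p 0 i \is a Num.int].
have exQ : exists k, Q k.
  have [k k0 kq] := common_denominator q; exists k.
  rewrite /Q k0; apply/forallP => i; rewrite pE mxE.
  have /intrP [z zE] := kq i.
  by rewrite -(ratr_nat R k) -rmorphM /= zE ratr_int intr_int.
case: (ex_minnP exQ) => m /andP[m0 /forallP mint] mmin.
exists m; split=> // k k0 kint; apply: mmin.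
by rewrite /Q k0; apply/forallP.
Qed.

(** * Firing counts in the hunger game *)

Section Firings.

Variables (R : realType) (n : nat) (P : 'M[R]_n.+1).

Let h (t : nat) : 'rV[R]_n.+1 := iter t (hunger_step P) 0.

Definition firings (t : nat) (i : 'I_n.+1) : nat :=
  \sum_(s < t) (i == hungriest (h s)).

Lemma firingsS t i : firings t.+1 i = (firings t i + (i == hungriest (h t)))%N.
Proof. by rewrite /firings big_ord_recr. Qed.

Lemma sum_firings t : (\sum_i firings t i)%N = t.
Proof.
elim: t => [|t IH].
  by rewrite big1 // => i _; rewrite /firings big_ord0.
under eq_bigr do rewrite firingsS.
by rewrite big_split /= IH -big_mkcond /= big_pred1_eq addn1.
Qed.

Let c (t : nat) : 'rV[R]_n.+1 := \row_i (firings t i)%:R.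

(** The row added by a step depends only on the state fired, so the counts matter and their order
    does not. *)
Lemma hunger_firings t : h t = c t *m P - c t.
Proof.
elim: t => [|t IH].
  rewrite (_ : c 0 = 0) ?mul0mx ?subrr //.
  by apply/rowP => i; rewrite !mxE /firings big_ord0.
have -> : c t.+1 = c t + delta_mx 0 (hungriest (h t)).
  by apply/rowP => i; rewrite !mxE firingsS natrD eqxx.
rewrite /h iterS -/(h t) /hunger_step {1}IH /hunger_matrix rowE mulmxBr mulmx1.
by rewrite mulmxDl opprD addrACA.
Qed.

Hypotheses (Pt : transition_matrix P) (Pirr : irreducible_chain P).
Variable p : 'rV[R]_n.+1.
Hypothesis pst : stationary_distribution P p.

Lemma return_firings t : h t = 0 -> forall i, (firings t i)%:R = t%:R * p 0 i.
Proof.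
move/eqP; rewrite hunger_firings subr_eq0 => /eqP cP i.
have/rowP/(_ i) := stationary_unique Pt Pirr pst cP; rewrite !mxE => ->.
congr (_ * _); under eq_bigr do rewrite mxE.
by rewrite -natr_sum sum_firings.
Qed.

Lemma sum_hunger t : \sum_i h t 0 i = 0.
Proof.
rewrite hunger_firings; under eq_bigr do rewrite !mxE.
rewrite sumrB exchange_big /=; apply/eqP; rewrite subr_eq0; apply/eqP.
by apply: eq_bigr => i _; rewrite -mulr_sumr Pt.2 mulr1 mxE.
Qed.

Lemma hunger_eq0 t : h t 0 (hungriest (h t)) <= 0 -> h t = 0.
Proof.
move=> hle; have [hmax _] := hungriestP (h t).
have hN i : 0 <= - h t 0 i by rewrite oppr_ge0 (le_trans (hmax i)).
have : \sum_i - h t 0 i == 0 by rewrite sumrN sum_hunger oppr0.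
rewrite psumr_eq0 => [/allP h0|i _]; last exact: hN.
apply/rowP => i; apply/eqP; rewrite mxE -oppr_eq0.
exact: h0 i (mem_index_enum _).
Qed.

Variables (m : nat) (v : 'I_n.+1 -> nat).
Hypothesis vE : forall i, (v i)%:R = m%:R * p 0 i.

Lemma firings_le t : (t <= m)%N -> forall i, (firings t i <= v i)%N.
Proof.
elim: t => [_ i|t IH lt_tm i]; first by rewrite /firings big_ord0.
have le_cv := IH (ltnW lt_tm); rewrite firingsS.
case: eqP => [iE|_]; last by rewrite addn0 le_cv.
rewrite addn1 ltn_neqAle le_cv andbT; apply/eqP => civ.
have h0 : h t = 0.
  apply: hunger_eq0; rewrite -iE hunger_firings.
  (* As [p P = p], adding [m p] and subtracting [m p P] changes nothing; at [i] the entry of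
     [m p - c] vanishes. *)
  have -> : c t *m P - c t = (m%:R *: p - c t) - (m%:R *: p - c t) *m P.
    case: pst => _ _ pP.
    by rewrite mulmxBl -scalemxAl pP opprB [RHS]addrC addrA subrK.
  rewrite !mxE -vE civ subrr add0r oppr_le0; apply: sumr_ge0 => j _.
  by rewrite mulr_ge0 ?Pt.1 // !mxE -vE subr_ge0 ler_nat.
(* A return at time [t] would give [t p_i = m p_i] with [p_i > 0], against [t < m]. *)
have /eqP := return_firings h0 i; rewrite civ vE.
rewrite (inj_eq (mulIf (lt0r_neq0 (stationary_gt0 _ Pt Pirr pst)))) eqr_nat.
by rewrite (gtn_eqF lt_tm).
Qed.

(** After [m] steps the counts lie below [v] and have the same sum [m], so they equal [v]. *)
Lemma hunger_return : h m = 0.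
Proof.
have v_sum : (\sum_i v i)%N = m.
  case: pst => _ p_sum _; apply/eqP; rewrite -(eqr_nat R) natr_sum.
  by under eq_bigr do rewrite vE; rewrite -mulr_sumr p_sum mulr1.
have cv i : firings m i = v i.
  have : (\sum_i (v i - firings m i) == 0)%N.
    rewrite sumnB => [|j _]; last exact: firings_le.
    by rewrite v_sum sum_firings subnn.
  rewrite sum_nat_eq0 => /forallP/(_ i); rewrite subn_eq0 => le_vc.
  by apply/eqP; rewrite eqn_leq firings_le.
have cE : c m = m%:R *: p by apply/rowP => i; rewrite !mxE cv vE.
by case: pst => _ _ pP; rewrite hunger_firings cE -scalemxAl pP subrr.
Qed.

End Firings.

(** * The return time of the zero vector *)

Lemma lcd_return_time (R : realType) (n : nat) (P : 'M[R]_n.+1)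
    (p : 'rV[R]_n.+1) (m : nat) :
  transition_matrix P -> irreducible_chain P -> stationary_distribution P p ->
  is_least_common_denominator p m -> is_return_time P 0 m.
Proof.
move=> Pt Pirr pst [m0 mint mmin]; split=> // [|k k0 hk].
  (* Each [m p_i] is a nonnegative integer, so truncation to [nat] loses nothing. *)
  apply: (hunger_return Pt Pirr pst (v := fun i => Num.truncn (m%:R * p 0 i))).
  move=> i; apply: truncnK; rewrite natrEint mint /=.
  by case: pst => p_ge0 _ _; rewrite mulr_ge0.
(* Minimality: a return after [k] steps makes each [k p_i] a firing count, so [k] is a common
   denominator. *)
by apply: mmin => // i; rewrite -(return_firings Pt Pirr pst hk) natr_int.
Qed.

Theorem proposition7p3 (R : realType) (n : nat) (P : 'M[R]_n.+1)
  (P_transition : transition_matrix P)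
  (P_rational : rational_entries P)
  (P_irreducible : irreducible_chain P)
  (P_nonabsorbing : forall k : 'I_n.+1, ~ absorbing P k) :
  hunger_recurrent P (0 : 'rV[R]_n.+1) /\
  (forall p : 'rV[R]_n.+1, stationary_distribution P p ->
     exists m : nat,
       is_least_common_denominator p m /\
       is_return_time P (0 : 'rV[R]_n.+1) m).
Proof.
have main (p : 'rV[R]_n.+1) : stationary_distribution P p ->
    exists m, is_least_common_denominator p m /\ is_return_time P 0 m.
  move=> pst.
  have [m mlcd] := lcd_exists P_transition P_rational P_irreducible pst.
  by exists m; split=> //; apply: lcd_return_time mlcd.
split=> //.
(* Recurrence calls for some stationary distribution to exist; the rational one serves. *)
have [q /main [m [_ [m0 hm _]]]] :=
  rational_stationary P_transition P_rational.
by exists m.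
Qed.
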